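(* Let $A$ be an $n\times n$ sign pattern matrix, and write $A=A_++A_-$, where $A_+$ is the sign pattern with $(A_+)_{ij}=+$ if $(A)_{ij}=+$ and $0$ otherwise, and $A_-$ is the sign pattern with $(A_-)_{ij}=-$ if $(A)_{ij}=-$ and $0$ otherwise. Define the $n\times n$ sign pattern $B_A=A_+-A_-^T$, i.e. $(B_A)_{ij}=+$ if $(A)_{ij}=+$ or $(A)_{ji}=-$, and $(B_A)_{ij}=0$ otherwise. If $A$ is irreducible and $B_A$ is reducible, then $A$ does not allow algebraic positivity.
   Context: A sign pattern is a matrix with entries in $\{+,-,0\}$. For an $n\times n$ sign pattern $S$, its pattern class $Q(S)$ is the set of real $n\times n$ matrices $X$ with $\mathrm{sgn}(X_{ij})=S_{ij}$ for all $i,j$. The digraph of $S$ has vertex set $\{1,\dots,n\}$ and an edge $(i,j)$ whenever $S_{ij}\neq 0$; $S$ is irreducible if this digraph is strongly connected, and reducible otherwise. A real square matrix $M$ is algebraically positive if there is a real polynomial $p$ with all entries of $p(M)$ positive. A sign pattern $S$ allows algebraic positivity if some $X\in Q(S)$ is algebraically positive. *)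

(* Defs.v *)
From HB Require Import structures.
From mathcomp Require Import all_boot all_order all_algebra.
From mathcomp Require Import reals.

Set Implicit Arguments.
Unset Strict Implicit.
Unset Printing Implicit Defensive.

Import Order.TTheory GRing.Theory Num.Theory.
Local Open Scope ring_scope.

Variant sign := Plus | Minus | Zero.

Definition sign_code (s : sign) : option bool :=
  match s with Plus => Some true | Minus => Some false | Zero => None end.

Definition sign_decode (o : option bool) : sign :=
  match o with Some true => Plus | Some false => Minus | None => Zero end.

Lemma sign_codeK : cancel sign_code sign_decode. Proof. by case. Qed.

HB.instance Definition _ := Equality.copy sign (can_type sign_codeK).

Definition sgn_of (R : realType) (x : R) : sign :=
  if x == 0 then Zero else if 0 < x then Plus else Minus.

Definition in_pattern_class (R : realType) (n : nat)
    (S : 'M[sign]_n) (X : 'M[R]_n) : Prop :=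
  forall i j, sgn_of (X i j) = S i j.

Definition digraph (n : nat) (S : 'M[sign]_n) : rel 'I_n :=
  [rel i j | S i j != Zero].

Definition irreducible (n : nat) (S : 'M[sign]_n) : Prop :=
  forall i j : 'I_n, connect (digraph S) i j.

Definition reducible (n : nat) (S : 'M[sign]_n) : Prop := ~ irreducible S.

Definition algebraically_positive (R : realType) (n : nat)
    (M : 'M[R]_n.+1) : Prop :=
  exists p : {poly R}, forall i j, 0 < horner_mx M p i j.

Definition allows_algebraic_positivity (R : realType) (n : nat)
    (S : 'M[sign]_n.+1) : Prop :=
  exists X : 'M[R]_n.+1, in_pattern_class S X /\ algebraically_positive X.

Definition pos_pattern (n : nat) (A : 'M[sign]_n) : 'M[sign]_n :=
  \matrix_(i, j) if A i j == Plus then Plus else Zero.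

Definition neg_pattern (n : nat) (A : 'M[sign]_n) : 'M[sign]_n :=
  \matrix_(i, j) if A i j == Minus then Minus else Zero.

(* The entrywise form of A_+ - A_-^T.  Sums of sign patterns are not total
   (+ plus - is ambiguous), but here only + and 0 are ever added;
   see [B_pattern_class]. *)
Definition B_pattern (n : nat) (A : 'M[sign]_n) : 'M[sign]_n :=
  \matrix_(i, j) if (A i j == Plus) || (A j i == Minus) then Plus else Zero.

Lemma sgn_of_Plus (R : realType) (x : R) : sgn_of x = Plus <-> 0 < x.
Proof. by rewrite /sgn_of; case: ltgtP. Qed.

Lemma sgn_of_Minus (R : realType) (x : R) : sgn_of x = Minus <-> x < 0.
Proof. by rewrite /sgn_of; case: ltgtP. Qed.

Lemma sgn_of_Zero (R : realType) (x : R) : sgn_of x = Zero <-> x = 0.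
Proof.
rewrite /sgn_of; case: eqP => // x0; split=> // H; exfalso; move: H.
by case: (0 < x).
Qed.

Lemma pos_neg_pattern_class (R : realType) (n : nat) (A : 'M[sign]_n)
    (X Y : 'M[R]_n) :
  in_pattern_class (pos_pattern A) X -> in_pattern_class (neg_pattern A) Y ->
  in_pattern_class A (X + Y).
Proof.
move=> hX hY i j; move: (hX i j) (hY i j); rewrite !mxE.
case: (A i j) => /=.
- by move=> /sgn_of_Plus x0 /sgn_of_Zero ->; apply/sgn_of_Plus; rewrite addr0.
- by move=> /sgn_of_Zero -> /sgn_of_Minus y0; apply/sgn_of_Minus; rewrite add0r.
- by move=> /sgn_of_Zero -> /sgn_of_Zero ->; apply/sgn_of_Zero; rewrite addr0.
Qed.

Lemma B_pattern_class (R : realType) (n : nat) (A : 'M[sign]_n)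
    (X Y : 'M[R]_n) :
  in_pattern_class (pos_pattern A) X -> in_pattern_class (neg_pattern A) Y ->
  in_pattern_class (B_pattern A) (X - Y^T).
Proof.
move=> hX hY i j; move: (hX i j) (hY j i); rewrite !mxE.
case: (A i j == Plus) => /=; case: (A j i == Minus) => /=.
- move=> /sgn_of_Plus x0 /sgn_of_Minus y0; apply/sgn_of_Plus.
  by rewrite addr_gt0 ?oppr_gt0.
- by move=> /sgn_of_Plus x0 /sgn_of_Zero ->; apply/sgn_of_Plus; rewrite subr0.
- move=> /sgn_of_Zero -> /sgn_of_Minus y0; apply/sgn_of_Plus.
  by rewrite add0r oppr_gt0.
- by move=> /sgn_of_Zero -> /sgn_of_Zero ->; apply/sgn_of_Zero; rewrite subr0.
Qed.

(* Main.v *)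
Require Import Defs.
From mathcomp Require Import all_boot all_order all_algebra.
From mathcomp Require Import reals.

Set Implicit Arguments.
Unset Strict Implicit.
Unset Printing Implicit Defensive.

Import Order.TTheory GRing.Theory Num.Theory.
Local Open Scope ring_scope.

(** Let [X] have sign pattern [A] and let [P = p(X)] be entrywise positive.  If
    [B_A] is reducible there is a proper nonempty set [S] of vertices with no
    edge of [B_A] leaving it, so [X] is nonpositive on [S x ~S] and nonnegative
    on [~S x S].  Since [X] and [P] commute, the partial trace over [S] of
    [X P - P X] vanishes; its [S x S] part cancels by symmetry, leaving
    [sum (X i j * P j i - P i j * X j i) = 0] over [i] in [S], [j] outside [S].
    All the terms are nonpositive, so [X] vanishes on [S x ~S], and [A] is
    reducible. *)

Lemma connect_mem (T : finType) (e : rel T) (S : {set T}) (x y : T) :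
  (forall i j, i \in S -> j \notin S -> ~~ e i j) ->
  connect e x y -> x \in S -> y \in S.
Proof.
move=> noexit /connectP[s + ->]; elim: s x => //= z s IHs x /andP[exz ezs] Sx.
apply: IHs ezs _; apply: contraLR exz; exact: noexit.
Qed.

Lemma comm_mx_cut_sum (R : comPzRingType) (n : nat) (X P : 'M[R]_n)
    (S : {set 'I_n}) :
  comm_mx X P ->
  \sum_(i in S) \sum_(j | j \notin S) X i j * P j i =
  \sum_(i in S) \sum_(j | j \notin S) P i j * X j i.
Proof.
move=> cXP.
have split_tr (Y Z : 'M[R]_n) : \sum_(i in S) (Y *m Z) i i =
    \sum_(i in S) \sum_(j in S) Y i j * Z j i +
    \sum_(i in S) \sum_(j | j \notin S) Y i j * Z j i.
  rewrite -big_split; apply: eq_bigr => i _.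
  by rewrite mxE (bigID [in S]).
have symS : \sum_(i in S) \sum_(j in S) P i j * X j i =
    \sum_(i in S) \sum_(j in S) X i j * P j i.
  rewrite exchange_big; apply: eq_bigr => i _.
  by apply: eq_bigr => j _; rewrite mulrC.
have := split_tr X P; rewrite cXP split_tr symS.
by move/(@addrI R)/esym.
Qed.

Theorem theorem4 (R : realType) (n : nat) (A : 'M[sign]_n.+1) :
  irreducible A -> reducible (B_pattern A) ->
  ~ allows_algebraic_positivity R A.
Proof.
move=> irrA redB [X [clX [p Ppos]]].
apply: redB => x y; apply: contraT => nBxy; exfalso.
(* The vertices reachable from [x] in [B_A]: no edge of [B_A] leaves this set, which contains [x]
   but not [y]. *)
pose S := [set k | connect (digraph (B_pattern A)) x k].
have noB i j : i \in S -> j \notin S -> A i j != Plus /\ A j i != Minus.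
  rewrite !inE => xi nxj.
  have : ~~ digraph (B_pattern A) i j.
    by apply: contra nxj => /connect1; apply: connect_trans.
  rewrite /digraph /= mxE.
  by case: (A i j == Plus); case: (A j i == Minus).
have X_le0 i j : i \in S -> j \notin S -> X i j <= 0.
  move=> iS jS; have [+ _] := noB _ _ iS jS.
  by rewrite leNgt; apply: contra => /sgn_of_Plus; rewrite clX => ->.
have X_ge0 i j : i \in S -> j \notin S -> 0 <= X j i.
  move=> iS jS; have [_] := noB _ _ iS jS.
  by rewrite leNgt; apply: contra => /sgn_of_Minus; rewrite clX => ->.
set P := horner_mx X p in Ppos.
(* The negated commutator term, so that the summands are nonnegative, as [psumr_eq0P] requires. *)
pose F i j := P i j * X j i - X i j * P j i.
have F_ge0 i j : i \in S -> j \notin S -> 0 <= F i j.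
  move=> iS jS; rewrite subr_ge0 (@le_trans _ _ 0) //.
    by rewrite mulr_le0_ge0 ?X_le0 ?ltW.
  by rewrite mulr_ge0 ?X_ge0 ?ltW.
have sumF0 : \sum_(i in S) \sum_(j | j \notin S) F i j = 0.
  under eq_bigr => i _ do rewrite sumrB.
  rewrite sumrB comm_mx_cut_sum ?subrr //.
  exact/comm_horner_mx/comm_mx_refl.
have X0 i j : i \in S -> j \notin S -> X i j = 0.
  move=> iS jS.
  have Fi0 : \sum_(k | k \notin S) F i k = 0.
    apply: (psumr_eq0P _ sumF0) iS => k kS.
    by apply: sumr_ge0 => l; apply: F_ge0.
  have /eqP : F i j = 0.
    by apply: (psumr_eq0P _ Fi0) jS => k; apply: F_ge0.
  rewrite subr_eq0 => /eqP PX.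
  (* The left side of [PX] is nonnegative and [P j i] is positive, which forces [0 <= X i j]. *)
  apply/eqP; rewrite eq_le X_le0 //= -(pmulr_lge0 _ (Ppos j i)) -PX.
  by rewrite mulr_ge0 ?X_ge0 ?ltW.
(* No edge of [A] leaves [S], yet [A] has a path from [x] to [y]. *)
have : y \in S.
  apply: connect_mem (irrA x y) _; last by rewrite inE connect0.
  move=> i j iS jS; rewrite /digraph /= negbK -clX.
  by apply/eqP/sgn_of_Zero/X0.
by rewrite inE (negPf nBxy).
Qed.
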